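(* Let $G = C_{16}(\{1,4,8\})$ and let $(s_1,\ldots,s_{16})$ be any $16$-tuple of positive integers. Then ${\rm Ind}(G^{(s_1,\ldots,s_{16})})$ is shellable but not vertex decomposable. Furthermore, for all $m \geq 1$, $G^{(m,\ldots,m)} = G[K_m]$ is a circulant graph whose independence complex is shellable but not vertex decomposable.
   Context: For $n\ge1$ and $S\subseteq\{1,\ldots,\lfloor n/2\rfloor\}$, the circulant graph $C_n(S)$ has vertex set $\{x_0,\ldots,x_{n-1}\}$, with $\{x_a,x_b\}$ an edge iff $|a-b|\in S$ or $n-|a-b|\in S$. For a graph $G$ on vertices $x_1,\ldots,x_n$ and positive integers $s_1,\ldots,s_n$, the expansion $G^{(s_1,\ldots,s_n)}$ is the graph on vertices $x_{i,j}$ ($1\le i\le n$, $1\le j\le s_i$) where $\{x_{i,j},x_{k,l}\}$ is an edge iff $\{x_i,x_k\}$ is an edge of $G$ or $i=k$ (distinct vertices). The lexicographical product $G[H]$ has vertex set $V_G\times V_H$, with $(w,x),(y,z)$ adjacent if $\{w,y\}\in E_G$, or $w=y$ and $\{x,z\}\in E_H$; $K_m$ is the complete graph on $m$ vertices. ${\rm Ind}(G)$ is the simplicial complex of independent sets of $G$. A pure simplicial complex $\Delta$ is shellable if its facets (maximal faces) can be ordered $F_1,\ldots,F_s$ so that for all $1\le j<i\le s$ there exist $x\in F_i\setminus F_j$ and $k<i$ with $\{x\}=F_i\setminus F_k$. A pure simplicial complex $\Delta$ is vertex decomposable if it has a unique facet, or there is a vertex $x$ such that ${\rm del}_\Delta(x)=\{F\in\Delta: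 x\notin F\}$ and ${\rm link}_\Delta(x)=\{F\in\Delta: x\notin F,\ F\cup\{x\}\in\Delta\}$ are vertex decomposable. *)

(* Defs.v *)
(* A finite simple graph is a symmetric, irreflexive [e : rel T]
   on a [T : finType]. A simplicial complex is a downward closed
   [D : {set {set T}}] containing the empty face; its vertices are the [x] with
   [[set x] \in D], not necessarily all of [T]. *)
From mathcomp Require Import all_boot all_order all_algebra.

Set Implicit Arguments.
Unset Strict Implicit.
Unset Printing Implicit Defensive.

Definition simple_graph (T : finType) (e : rel T) : Prop :=
  symmetric e /\ irreflexive e.

Definition graph_iso (T U : finType) (e : rel T) (e' : rel U) : Prop :=
  exists2 f : T -> U, bijective f & {mono f : x y / e x y >-> e' x y}.

(* The finite set [S] is given as a list; the constraint that it consists of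
   integers between 1 and [n./2] is [circulant_set n S]. *)
Definition circulant_set (n : nat) (S : seq nat) : Prop :=
  {in S, forall d, 0 < d <= n./2}.

Definition circulant (n : nat) (S : seq nat) : rel 'I_n :=
  fun a b => (`|a - b|%N \in S) || (n - `|a - b|%N \in S).

Definition is_circulant (T : finType) (e : rel T) : Prop :=
  exists n S, [/\ 0 < n, circulant_set n S & graph_iso e (@circulant n S)].

Definition complete (m : nat) : rel 'I_m := fun x y => x != y.

Definition expansion (T : finType) (e : rel T) (s : T -> nat) :
    rel {i : T & 'I_(s i)} :=
  fun u v => (u != v) && (e (tag u) (tag v) || (tag u == tag v)).

Definition lexprod (T U : finType) (e : rel T) (e' : rel U) : rel (T * U) :=
  fun u v => e u.1 v.1 || (u.1 == v.1) && e' u.2 v.2.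

Lemma circulant_simple n S :
  0 < n -> circulant_set n S -> simple_graph (@circulant n S).
Proof.
move=> n_gt0 HS; split=> [a b|a]; rewrite /circulant; first by rewrite distnC.
rewrite distnn subn0; apply/negP=> /orP[] /HS /andP[] //.
move=> _; apply/negP; rewrite -ltnNge -divn2; exact: ltn_Pdiv.
Qed.

Lemma complete_simple m : simple_graph (@complete m).
Proof. by split=> [x y|x]; rewrite /complete ?eqxx // eq_sym. Qed.

Lemma expansion_simple (T : finType) (e : rel T) (s : T -> nat) :
  simple_graph e -> simple_graph (@expansion T e s).
Proof.
case=> e_sym _; split=> [u v|u]; last by rewrite /expansion eqxx.
by rewrite /expansion e_sym eq_sym [tag u == _]eq_sym.
Qed.

Lemma lexprod_simple (T U : finType) (e : rel T) (e' : rel U) :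
  simple_graph e -> simple_graph e' -> simple_graph (lexprod e e').
Proof.
move=> [se ie] [se' ie']; split=> [u v|u]; last by rewrite /lexprod ie ie' andbF.
by rewrite /lexprod se se' eq_sym.
Qed.

Section Complexes.

Variable T : finType.
Implicit Types (D : {set {set T}}) (F : {set T}) (x : T).

Definition simplicial_complex D : Prop :=
  set0 \in D /\ forall A B : {set T}, A \in D -> B \subset A -> B \in D.

Definition facets D : {set {set T}} := [set F | maxset (mem D) F].

Definition pure_complex D : Prop :=
  simplicial_complex D /\ {in facets D &, forall F F', #|F| = #|F'|}.

Definition shelling D (Fs : seq {set T}) : Prop :=
  [/\ uniq Fs, Fs =i facets D &
      forall i j, j < i < size Fs ->
      exists x k, [/\ x \in nth set0 Fs i :\: nth set0 Fs j, k < i &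
                      [set x] = nth set0 Fs i :\: nth set0 Fs k]].

Definition shellable D : Prop :=
  pure_complex D /\ exists Fs : seq {set T}, shelling D Fs.

Definition del D x : {set {set T}} := [set F in D | x \notin F].

Definition link D x : {set {set T}} :=
  [set F in D | (x \notin F) && (x |: F \in D)].

(* Purity is required at every stage of the recursion, so the deletion and the
   link of a chosen vertex have to be pure as well. *)
Inductive vertex_decomposable D : Prop :=
| VD_simplex of pure_complex D & #|facets D| = 1
| VD_vertex x of pure_complex D & [set x] \in D &
    vertex_decomposable (del D x) & vertex_decomposable (link D x).

Definition Ind (e : rel T) : {set {set T}} :=
  [set A : {set T} | [forall x in A, forall y in A, ~~ e x y]].

Lemma Ind_complex (e : rel T) : simplicial_complex (Ind e).
Proof.
split=> [|A B]; rewrite !inE.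
  by apply/forall_inP=> x; rewrite inE.
move=> /forall_inP HA /subsetP sBA; apply/forall_inP=> x /sBA /HA /forall_inP Hx.
by apply/forall_inP=> y /sBA /Hx.
Qed.

Lemma del_complex D x : simplicial_complex D -> simplicial_complex (del D x).
Proof.
move=> [D0 DS]; split=> [|A B]; rewrite !inE ?D0 //.
move=> /andP[DA xA] sBA; rewrite (DS _ _ DA sBA) /=.
by apply: contra xA; exact: (subsetP sBA).
Qed.

Lemma link_complex D x :
  simplicial_complex D -> [set x] \in D -> simplicial_complex (link D x).
Proof.
move=> [D0 DS] Dx; split=> [|A B]; rewrite !inE ?D0 ?setU0 //.
move=> /and3P[DA xA DxA] sBA; rewrite (DS _ _ DA sBA) (DS _ _ DxA) ?setUS //.
by rewrite andbT; apply: contra xA; exact: (subsetP sBA).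
Qed.

End Complexes.

(* Main.v *)
(* Both [expansion G s] and [lexprod G (complete m)] replace every vertex of [G]
   by a clique; we call this [blowup G p], where [p] maps a new vertex to the old
   one. The facets of the independence complex of a blow-up are the lifts of the
   facets of [Ind G] along sections of [p]. Ordering them by a shelling of
   [Ind G] and then by the sum of the positions of the chosen vertices gives a
   shelling. Conversely a vertex decomposition of the blow-up descends to
   [Ind G]: deleting a vertex which is not the last of its fibre changes nothing
   downstairs, and deleting (linking) the last one is a deletion (link) of its
   image.
   For [G] = C_16(1,4,8) itself an explicit shelling of the 80 facets is checked
   by computation. Non-decomposability is certified by a list of induced
   subgraphs, [G] among them, closed up to dihedral symmetry in the following
   sense: each has at least two facets, and for each vertex [x] of a member
   either the deletion of [x] is not pure, or the deletion or the link of [x] is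
   again in the list. *)
Require Import Defs.
From mathcomp Require Import all_boot all_order all_algebra zify.

Set Implicit Arguments.
Unset Strict Implicit.
Unset Printing Implicit Defensive.

(** * Independence complexes of induced subgraphs *)

Section RestrictedInd.

Variables (T : finType) (e : rel T).
Hypotheses (e_sym : symmetric e) (e_irr : irreflexive e).
Implicit Types (W F A : {set T}) (x y : T).

(** Induced subgraphs are kept as subsets [W] of the fixed type [T], so that deletions and links are
    again of the form [Indr W']. *)
Definition Indr W : {set {set T}} := [set A in Ind e | A \subset W].

Lemma IndP A : reflect {in A &, forall x y, ~~ e x y} (A \in Ind e).
Proof.
rewrite inE; apply: (iffP forall_inP) => [H x y Ax Ay|H x Ax].
  exact: (forall_inP (H x Ax)).
by apply/forall_inP => y; apply: H.
Qed.

Lemma in_Indr W A : (A \in Indr W) = (A \in Ind e) && (A \subset W).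
Proof. by rewrite in_set. Qed.

Lemma Indr_setT : Indr setT = Ind e.
Proof. by apply/setP => A; rewrite in_Indr subsetT andbT. Qed.

Lemma Indr_complex W : simplicial_complex (Indr W).
Proof.
have [I0 IS] := Ind_complex e; split=> [|A B].
  by rewrite in_Indr I0 sub0set.
rewrite !in_Indr => /andP[IA AW] BA.
by rewrite (IS _ _ IA BA) (subset_trans BA).
Qed.

Lemma set1_Indr W x : ([set x] \in Indr W) = (x \in W).
Proof.
rewrite in_Indr sub1set andb_idl // => _; apply/IndP => u v.
by rewrite !inE => /eqP-> /eqP->; rewrite e_irr.
Qed.

Lemma del_Indr W x : del (Indr W) x = Indr (W :\ x).
Proof. by apply/setP => A; rewrite in_set !in_Indr subsetD1 andbA. Qed.

Definition unjoined W x : {set T} := [set y in W | (y != x) && ~~ e x y].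

Lemma link_Indr W x : x \in W -> link (Indr W) x = Indr (unjoined W x).
Proof.
move=> Wx; apply/setP => A; rewrite [in LHS]in_set.
apply/idP/idP => [/and3P[]|].
  rewrite !in_Indr => /andP[IA AW] xA /andP[/IndP IxA _].
  rewrite IA; apply/subsetP => y Ay; rewrite inE (subsetP AW) //=.
  by rewrite (contraNneq _ xA) => [|<- //]; rewrite IxA // !inE ?eqxx ?Ay ?orbT.
rewrite !in_Indr => /andP[IA /subsetP AW].
have AxW : A \subset W by apply/subsetP => y /AW; rewrite inE => /andP[].
rewrite IA AxW subUset sub1set Wx AxW !andbT /=; apply/andP; split.
  by apply/negP => /AW; rewrite !inE eqxx andbF.
apply/IndP => u v; rewrite !inE => /predU1P[->|Au] /predU1P[->|Av].
- by rewrite e_irr.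
- by have /AW := Av; rewrite inE => /and3P[].
- by have /AW := Au; rewrite inE e_sym => /and3P[].
- by move/IndP: IA; apply.
Qed.

(** One inclusion says that [F] is an independent subset of [W], the other that it is maximal. A
    single equation of sets is easy to test by computation. *)
Lemma facets_Indr W F :
  (F \in facets (Indr W)) = (F == [set v in W | [forall u in F, ~~ e v u]]).
Proof.
rewrite inE; apply/maxsetP/eqP => [[DF maxF]|FE].
  have /andP[IF FW] : (F \in Ind e) && (F \subset W) by rewrite -in_Indr.
  apply/setP => v; rewrite inE.
  apply/idP/andP => [Fv|[Wv /forall_inP Nv]].
    by split; [exact: (subsetP FW)|apply/forall_inP => u; apply/IndP].
  have <- : v |: F = F; last exact: setU11.
  apply: maxF; last exact: subsetUr.
  rewrite -[mem _ _]/(_ \in Indr W) in_Indr subUset sub1set Wv FW !andbT.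
  apply/IndP => x y.
  rewrite !inE => /predU1P[->|Fx] /predU1P[->|Fy]; rewrite ?e_irr ?Nv //.
    by rewrite e_sym Nv.
  by move/IndP: IF; apply.
have inF v : v \in F -> v \in W /\ {in F, forall u, ~~ e v u}.
  by rewrite {1}FE inE => /andP[-> /forall_inP].
split=> [|B]; rewrite -[mem _ _]/(_ \in Indr W) in_Indr.
  apply/andP; split; last by apply/subsetP => v /inF[].
  by apply/IndP => x y /inF[_]; apply.
move=> /andP[/IndP IB /subsetP BW] FB; apply/eqP.
rewrite eqEsubset FB andbT; apply/subsetP => v Bv; rewrite FE inE BW //.
by apply/forall_inP => u /(subsetP FB); apply: IB.
Qed.

Lemma facets_IndrP W F :
  reflect [/\ F \subset W, {in F &, forall u v, ~~ e u v} &
              forall v, v \in W -> v \notin F -> exists2 u, u \in F & e v u]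
          (F \in facets (Indr W)).
Proof.
rewrite facets_Indr; apply: (iffP eqP) => [FE|[FW IF maxF]].
  split; first by apply/subsetP => v; rewrite {1}FE inE => /andP[].
    by move=> u v; rewrite {1}FE inE => /andP[_ /forall_inP]; apply.
  move=> v Wv; rewrite {1}FE inE Wv /= => /forall_inPn[u Fu euv].
  by exists u; rewrite // -[e v u]negbK.
apply/setP => v; rewrite inE; apply/idP/andP => [Fv|[Wv /forall_inP Nv]].
  by split; [exact: (subsetP FW)|apply/forall_inP => u; apply: IF].
by apply: contraT => /maxF - /(_ Wv)[u /Nv/negP].
Qed.

Lemma facets_Indr_neq0 W : exists F, F \in facets (Indr W).
Proof.
have [F maxF _] := maxset_exists (Indr_complex W).1.
by exists F; rewrite inE.
Qed.

Lemma facets_del W F x :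
  F \in facets (Indr W) -> x \notin F -> F \in facets (Indr (W :\ x)).
Proof.
case/facets_IndrP => FW IF maxF xF; apply/facets_IndrP; split=> //.
  by rewrite subsetD1 FW.
by move=> v /setD1P[_]; apply: maxF.
Qed.

End RestrictedInd.

(** * Shellings from rank functions *)

Section ShellingByRank.

Variables (T : finType) (D : {set {set T}}).

(** Ties are covered by [r F' <= r F] while [F''] must have strictly smaller rank. Hence facets of
    equal rank may be listed in any order, and sorting by [r] gives a shelling. *)
Definition shelling_rank (r : {set T} -> nat) : Prop :=
  forall F F', F \in facets D -> F' \in facets D -> F' != F -> r F' <= r F ->
  exists x F'', [/\ x \in F :\: F', F'' \in facets D, r F'' < r F &
                    F :\: F'' = [set x]].

Lemma shellable_of_rank r : pure_complex D -> shelling_rank r -> shellable D.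
Proof.
move=> pureD rP; split=> //; pose leT := relpre r leq.
have leT_tr : transitive leT by move=> ? ? ?; apply: leq_trans.
have leT_refl : reflexive leT by move=> ?; apply: leqnn.
pose Fs := sort leT (enum (facets D)); exists Fs.
have Fs_sorted : sorted leT Fs by apply: sort_sorted => ? ?; apply: leq_total.
have Fs_uniq : uniq Fs by rewrite sort_uniq enum_uniq.
have FsE : Fs =i facets D by move=> F; rewrite mem_sort mem_enum.
split=> // i j /andP[ji isz]; have jsz := ltn_trans ji isz.
have r_le a b : a <= b < size Fs -> r (nth set0 Fs a) <= r (nth set0 Fs b).
  move=> /andP[ab bsz]; apply: (sorted_leq_nth leT_tr leT_refl) => //.
  by rewrite inE (leq_ltn_trans ab).
have [||||x [F'' [xF D'' r'' dF]]] := rP (nth set0 Fs i) (nth set0 Fs j).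
- by rewrite -FsE mem_nth.
- by rewrite -FsE mem_nth.
- by rewrite nth_uniq // neq_ltn ji.
- by rewrite r_le // isz ltnW.
have Fs'' : F'' \in Fs by rewrite FsE.
exists x, (index F'' Fs); split; rewrite ?nth_index // ltnNge.
apply: contraL r'' => i_le; rewrite -leqNgt -(nth_index set0 Fs'').
by rewrite r_le // i_le index_mem.
Qed.

Lemma shelling_rank_index Fs :
  shelling D Fs -> shelling_rank (fun F => index F Fs).
Proof.
move=> [_ FsE FsP] F F'; rewrite -!FsE => FsF FsF' neq le_r.
have [|x [k [xF k_lt dF]]] := FsP (index F Fs) (index F' Fs).
  rewrite index_mem FsF andbT ltn_neqAle le_r andbT.
  by apply: contra neq => /eqP/(index_inj set0 FsF' FsF)->.
have k_sz : k < size Fs by rewrite (ltn_trans k_lt) // index_mem.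
exists x, (nth set0 Fs k); move: xF dF; rewrite !nth_index // => xF dF.
split; rewrite -?FsE ?mem_nth // (leq_ltn_trans _ k_lt) //.
exact: index_nth.
Qed.

End ShellingByRank.

(** * Blow-ups *)

Section Blowup.

Variables (T U : finType) (e : rel U) (p : T -> U).
Hypotheses (e_sym : symmetric e) (e_irr : irreflexive e).

Definition blowup : rel T :=
  fun x y => (x != y) && (e (p x) (p y) || (p x == p y)).

Lemma blowup_sym : symmetric blowup.
Proof. by move=> x y; rewrite /blowup e_sym eq_sym [p x == _]eq_sym. Qed.

Lemma blowup_irr : irreflexive blowup.
Proof. by move=> x; rewrite /blowup eqxx. Qed.

Let facetsP := facets_IndrP e_sym e_irr.
Let bfacetsP := facets_IndrP blowup_sym blowup_irr.

(** Fibres of [p] are cliques, so an independent set meets each of them at most once. *)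
Lemma facets_blowup_inj W F :
  F \in facets (Indr blowup W) -> {in F &, injective p}.
Proof.
case/bfacetsP => _ IF _ x y Fx Fy pxy; have := IF x y Fx Fy.
by rewrite /blowup pxy eqxx orbT andbT negbK => /eqP.
Qed.

Lemma facets_blowup_proj W F :
  F \in facets (Indr blowup W) -> p @: F \in facets (Indr e (p @: W)).
Proof.
move=> facF; have injF := facets_blowup_inj facF.
case/bfacetsP: facF => FW IF maxF; apply/facetsP; split; first exact: imsetS.
  move=> _ _ /imsetP[x Fx ->] /imsetP[y Fy ->]; have := IF x y Fx Fy.
  rewrite /blowup negb_and negbK negb_or => /predU1P[->|/andP[]//].
  by rewrite e_irr.
move=> _ /imsetP[x Wx ->] pxF.
have xF : x \notin F by apply: contra pxF => /(imset_f p).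
have [y Fy /andP[_ /orP[exy|/eqP pxy]]] := maxF x Wx xF.
  by exists (p y); rewrite ?imset_f.
by rewrite pxy imset_f in pxF.
Qed.

Lemma facets_blowup_lift (W : {set T}) (K : {set U}) h :
    {in K, forall u, h u \in W} -> {in K, cancel h p} ->
  K \in facets (Indr e (p @: W)) -> h @: K \in facets (Indr blowup W).
Proof.
move=> hW hK /facetsP[KW IK maxK]; apply/bfacetsP; split.
- by apply/subsetP => _ /imsetP[u Ku ->]; apply: hW.
- move=> _ _ /imsetP[u Ku ->] /imsetP[v Kv ->].
  rewrite /blowup !hK // (negPf (IK u v Ku Kv)) /=.
  by case: (u =P v) => [->|]; rewrite ?eqxx ?andbF.
move=> x Wx xF; have [Kx|Kx] := boolP (p x \in K).
  exists (h (p x)); rewrite ?imset_f // /blowup hK // eqxx orbT andbT.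
  by apply: contra xF => /eqP->; apply: imset_f.
have [u Ku exu] := maxK _ (imset_f p Wx) Kx.
exists (h u); rewrite ?imset_f // /blowup hK // exu andbT.
by apply: contra xF => /eqP->; apply: imset_f.
Qed.

Lemma card_lift (K : {set U}) h : {in K, cancel h p} -> #|h @: K| = #|K|.
Proof. by move=> hK; apply: card_in_imset; apply: can_in_inj hK. Qed.

Lemma imset_lift (K : {set U}) h : {in K, cancel h p} -> p @: (h @: K) = K.
Proof.
move=> hK; rewrite -imset_comp -[RHS]imset_id; apply: eq_in_imset => u Ku.
exact: hK.
Qed.

Lemma lift_facet (W : {set T}) (K : {set U}) : K \in facets (Indr e (p @: W)) ->
  exists2 F, F \in facets (Indr blowup W) & p @: F = K /\ #|F| = #|K|.
Proof.
(* A nonempty [W] supplies the default value [x0] for the choice of preimages below. *)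
move=> facK; have [W0|[x0 Wx0]] := set_0Vmem W.
  case/facetsP: (facK); rewrite W0 imset0 subset0 => /eqP-> _ _.
  have [F facF] := facets_Indr_neq0 blowup set0; exists F => //.
  have [] := bfacetsP _ _ facF; rewrite subset0 => /eqP-> _ _.
  by rewrite imset0 !cards0.
have [KW _ _] := facetsP _ _ facK.
pose h u := odflt x0 [pick x in W | p x == u].
have hP : {in K, forall u, h u \in W /\ p (h u) = u}.
  move=> u /(subsetP KW)/imsetP[x Wx ->]; rewrite /h.
  by case: pickP => [y /andP[Wy /eqP]|/(_ x)]; rewrite ?Wx ?eqxx.
have hK : {in K, cancel h p} by move=> u /hP[].
exists (h @: K); last by rewrite imset_lift // card_lift.
by apply: facets_blowup_lift => // u /hP[].
Qed.

(** Every facet downstairs lifts to a facet of the same cardinality. *)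
Lemma pure_blowup W :
  pure_complex (Indr blowup W) -> pure_complex (Indr e (p @: W)).
Proof.
case=> _ eqc; split; first exact: Indr_complex.
move=> K K' /lift_facet[F facF [_ <-]] /lift_facet[F' facF' [_ <-]].
exact: eqc.
Qed.

(* If another vertex of the fibre of [x] survives, deleting [x] changes nothing
   downstairs. *)
Lemma vertex_decomposable_blowup W :
  vertex_decomposable (Indr blowup W) -> vertex_decomposable (Indr e (p @: W)).
Proof.
move DE: (Indr blowup W) => D vdD.
elim: vdD W DE => {D} [D pureD oneD|D x pureD Dx _ IHdel _ IHlink] W DE.
  apply: VD_simplex; first by apply: pure_blowup; rewrite DE.
  have [K facK] := facets_Indr_neq0 e (p @: W).
  move/eqP/cards1P: oneD => [F0 FE]; apply/eqP/cards1P; exists K.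
  apply/setP => K'; rewrite inE; apply/idP/eqP => [|-> //].
  (* Two facets downstairs lift to the unique facet upstairs, so they are both its image. *)
  have [F + [<- _]] := lift_facet facK.
  move=> facF /lift_facet[F' facF' [<- _]].
  by move: facF facF'; rewrite DE FE !inE => /eqP-> /eqP->.
have Wx : x \in W by rewrite -DE set1_Indr // in Dx; apply: blowup_irr.
have {}IHdel : vertex_decomposable (Indr e (p @: (W :\ x))).
  by apply: IHdel; rewrite -DE del_Indr.
have {}IHlink : vertex_decomposable (Indr e (p @: unjoined blowup W x)).
  by apply: IHlink; rewrite -DE (link_Indr blowup_sym blowup_irr).
have [/imsetP[y Wy pxy]|px] := boolP (p x \in p @: (W :\ x)).
  suff <- : p @: (W :\ x) = p @: W by [].
  rewrite -[in RHS](setD1K Wx) imsetU1 pxy; apply/esym/setUidPr.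
  by rewrite sub1set imset_f.
apply: (@VD_vertex _ _ (p x)).
- by apply: pure_blowup; rewrite DE.
- by rewrite set1_Indr // imset_f.
- rewrite del_Indr -(setD1K Wx) imsetU1 setU1K //; exact: IHdel.
rewrite (link_Indr e_sym e_irr) ?imset_f //.
(* The neighbours of [x] include the rest of its fibre, so the surviving vertices lie over vertices
   distinct from [p x] and not adjacent to it. *)
suff <- : p @: unjoined blowup W x = unjoined e (p @: W) (p x) by [].
apply/setP => u; rewrite inE; apply/imsetP/andP.
  move=> [y]; rewrite inE => /and3P[Wy yx nxy] ->; rewrite imset_f //.
  by move: nxy; rewrite /blowup eq_sym yx negb_or andbC eq_sym.
case=> /imsetP[y Wy ->] /andP[pyx nxy]; exists y => //.
rewrite inE Wy /blowup (negPf nxy) [p x == _]eq_sym (negPf pyx) andbF andbT.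
by apply: contra pyx => /eqP->.
Qed.

(** * Shellings of blow-ups *)

Hypothesis p_surj : forall u, exists x, p x = u.

Lemma imset_p_setT : p @: [set: T] = setT.
Proof.
by apply/setP => u; rewrite inE; have [x <-] := p_surj u; rewrite imset_f.
Qed.

(** Over [p @: F] the section picks the only point of [F] in the fibre; elsewhere it is arbitrary.
    Being total, it can also lift other facets. *)
Lemma facet_section F : F \in facets (Ind blowup) ->
  exists2 h, cancel h p & {in F, cancel p h}.
Proof.
rewrite -Indr_setT => /facets_blowup_inj injF.
have [g gK] := fin_all_exists p_surj.
pose h u := odflt (g u) [pick x in F | p x == u].
exists h => [u|x Fx]; rewrite /h.
  by case: pickP => [x /andP[_ /eqP]|_ /=].
case: pickP => [y /andP[Fy /eqP pyx]|/(_ x)]; last by rewrite Fx eqxx.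
exact: injF.
Qed.

Lemma facet_lift_setT (K : {set U}) h :
  cancel h p -> K \in facets (Ind e) -> h @: K \in facets (Ind blowup).
Proof.
move=> hK facK; rewrite -Indr_setT; apply: facets_blowup_lift => [u _|u _|].
- by rewrite inE.
- exact: hK.
- by rewrite imset_p_setT Indr_setT.
Qed.

Lemma facet_proj_setT F : F \in facets (Ind blowup) -> p @: F \in facets (Ind e).
Proof.
by rewrite -!Indr_setT => /facets_blowup_proj; rewrite imset_p_setT.
Qed.

Lemma section_imset (F : {set T}) h : {in F, cancel p h} -> h @: (p @: F) = F.
Proof.
move=> hK; rewrite -imset_comp -[RHS]imset_id; apply: eq_in_imset => x Fx.
exact: hK.
Qed.

(** Since [bound] exceeds every weight, [i * bound + weight F] encodes the lexicographic order on
    pairs of a rank and a weight. *)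
Let weight (F : {set T}) : nat := \sum_(x in F) enum_rank x.
Let bound := (\sum_(x : T) enum_rank x).+1.

Let weight_lt F : weight F < bound.
Proof.
rewrite /weight big_mkcond ltnS leq_sum // => x _.
by case: ifP => // _; apply: leqnn.
Qed.

Let rank_lt i j F F' : i < j -> i * bound + weight F < j * bound + weight F'.
Proof.
move=> ij; apply: leq_trans (leq_addr _ _).
apply: leq_trans (leq_mul ij (leqnn bound)).
by rewrite mulSn addnC ltn_add2r weight_lt.
Qed.

Let weight_lift h (K : {set U}) :
  cancel h p -> weight (h @: K) = \sum_(u in K) enum_rank (h u).
Proof.
by move=> hK; rewrite /weight big_imset // => u v _ _; apply: can_inj hK u v.
Qed.

(* The facets upstairs are the [h @: K] for a facet [K] downstairs and a section
   [h]. They are ordered by the rank of [K], then by the sum of the positions of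
   the chosen vertices: among two choices over the same [K], the one with the
   larger sum has a coordinate which can be lowered to the other's. *)
Lemma shelling_rank_blowup r : shelling_rank (Ind e) r ->
  shelling_rank (Ind blowup) (fun F => r (p @: F) * bound + weight F).
Proof.
move=> rP F F' facF facF' neqF le_r.
have [h hK hF] := facet_section facF; have [h' h'K h'F'] := facet_section facF'.
have [eqK|neqK] := eqVneq (p @: F') (p @: F); last first.
  have le_r0 : r (p @: F') <= r (p @: F).
    rewrite leqNgt; apply: contraL le_r => lt_r; rewrite -ltnNge.
    exact: rank_lt.
  (* The exchange is made downstairs; lifting [K] along the section of [F] itself keeps all other
     vertices of [F]. *)
  have [u [K [uF facK lt_r dF]]] :=
    rP _ _ (facet_proj_setT facF) (facet_proj_setT facF') neqK le_r0.
  have [/imsetP[x Fx ux] uF'] := setDP uF.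
  exists x, (h @: K); split.
  - rewrite inE Fx andbT; apply: contra uF'; rewrite ux; exact: imset_f.
  - exact: facet_lift_setT.
  - rewrite imset_lift; last by move=> v _; apply: hK.
    exact: rank_lt.
  apply/setP => y; rewrite !inE; apply/andP/eqP => [[yK Fy]|->].
    have : p y \in p @: F :\: K.
      rewrite inE imset_f // andbT; apply: contra yK => Ky.
      by rewrite -(hF y Fy) imset_f.
    by rewrite dF inE ux => /eqP pyx; rewrite -(hF y Fy) pyx hF.
  split=> //; apply/negP => /imsetP[v Kv xv].
  have : u \in p @: F :\: K by rewrite dF set11.
  by rewrite inE ux xv hK Kv.
set K := p @: F in eqK le_r.
have FE : F = h @: K by rewrite section_imset.
have F'E : F' = h' @: K by rewrite -eqK section_imset.
have facK : K \in facets (Ind e) by apply: facet_proj_setT.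
have le_w : \sum_(u in K) enum_rank (h' u) <= \sum_(u in K) enum_rank (h u).
  by rewrite eqK leq_add2l in le_r; rewrite -!weight_lift // -FE -F'E.
(* Otherwise [h] is at most [h'] at each point of [K]; as the sums compare the other way, both agree
   on [K] and [F = F']. *)
have [u Ku lt_u] : exists2 u, u \in K & enum_rank (h' u) < enum_rank (h u).
  apply/exists_inP; apply: contraNT neqF => /exists_inPn geK.
  have leK u : u \in K -> enum_rank (h u) <= enum_rank (h' u).
    by move/geK; rewrite -leqNgt.
  have eq_w := leqif_sum (fun u Ku => leqif_eq (leK u Ku)).
  have /esym := eq_w.2; rewrite eqn_leq le_w eq_w.1 => /forall_inP eqK'.
  rewrite FE F'E; apply/eqP/eq_in_imset => v Kv; apply/enum_rank_inj/val_inj.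
  by apply/esym/eqP/eqK'.
(* Changing the choice over [u] alone lowers the sum and removes from [F] only [h u], which is not
   in [F']. *)
pose h'' v := if v == u then h' u else h v.
have h''K : cancel h'' p by move=> v; rewrite /h''; case: eqP => [->|].
have neq_u : h' u != h u by apply: contraTneq lt_u => ->; rewrite ltnn.
exists (h u), (h'' @: K); split.
- rewrite inE FE imset_f // andbT F'E; apply: contra neq_u => /imsetP[v Kv huv].
  by have := hK u; rewrite huv h'K => ->.
- exact: facet_lift_setT.
- rewrite imset_lift; last by move=> v _; apply: h''K.
  rewrite ltn_add2l [in X in _ < weight X]FE !weight_lift //.
  rewrite (bigD1 u) //= [X in _ < X](bigD1 u) //= /h'' eqxx -addSn leq_add //.
  by apply: leq_sum => v /andP[_ /negPf->].
apply/setP => y; rewrite FE !inE; apply/andP/eqP => [[yK /imsetP[v Kv yv]]|->].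
  rewrite yv; congr (h _); apply: contraNeq yK => vu.
  by rewrite yv; apply/imsetP; exists v; rewrite // /h'' (negPf vu).
split; last exact: imset_f.
apply: contra neq_u => /imsetP[v Kv]; rewrite /h''.
by case: eqP => [_ ->//|vu /(can_inj hK)/esym/vu].
Qed.

Lemma shellable_blowup : shellable (Ind e) -> shellable (Ind blowup).
Proof.
case=> -[_ eqc] [Fs /shelling_rank_index /shelling_rank_blowup].
apply: shellable_of_rank; split=> [|F F' facF facF']; first exact: Ind_complex.
have cardF A : A \in facets (Ind blowup) -> #|A| = #|p @: A|.
  by rewrite -Indr_setT => /facets_blowup_inj/card_in_imset.
by rewrite !cardF //; apply: eqc; apply: facet_proj_setT.
Qed.

Lemma not_vertex_decomposable_blowup :
  ~ vertex_decomposable (Ind e) -> ~ vertex_decomposable (Ind blowup).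
Proof.
rewrite -!Indr_setT => nvd /vertex_decomposable_blowup.
by rewrite imset_p_setT.
Qed.

End Blowup.

(** * Computing with graphs on bit sequences *)

Section Bits.

Variables (n : nat) (adj : seq (seq nat)).
Implicit Types (s f W D : bitseq) (q : seq nat) (C : seq bitseq).

Definition nbr v : seq nat := nth [::] adj v.
Definition adj_rel : rel 'I_n := fun i j => val j \in nbr i.

Definition set_of_bits s : {set 'I_n} := [set i : 'I_n | nth false s i].

Definition isolated s v : bool := ~~ has (nth false s) (nbr v).
(** Boolean counterpart of the equation in [facets_Indr]. *)
Definition is_facet W f : bool :=
  f == mkseq (fun v => nth false W v && isolated f v) n.
Definition remove W x := mkseq (fun v => nth false W v && (v != x)) n.
Definition link_verts W x :=
  mkseq (fun v => nth false W v && ((v != x) && (v \notin nbr x))) n.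

(** Enumerates the independent subsets of [W] among the first [k] vertices. Bits past the end of [s]
    read as [false], so [isolated s k'] tests only neighbours below [k']. *)
Fixpoint indep_seq W k : seq bitseq :=
  if k is k'.+1 then
    let ss := indep_seq W k' in
    [seq rcons s false | s <- ss] ++
    (if nth false W k' then [seq rcons s true | s <- ss & isolated s k'] else [::])
  else [:: [::]].

Definition facet_seq W : seq bitseq := [seq f <- indep_seq W n | is_facet W f].

Lemma nth_mkseq_ord (g : nat -> bool) (i : 'I_n) : nth false (mkseq g n) i = g i.
Proof. exact: nth_mkseq. Qed.

Lemma set_of_mkseq g : set_of_bits (mkseq g n) = [set i : 'I_n | g i].
Proof. by apply/setP => i; rewrite !inE nth_mkseq_ord. Qed.

Lemma set_of_remove W (x : 'I_n) : set_of_bits (remove W x) = set_of_bits W :\ x.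
Proof. by rewrite set_of_mkseq; apply/setP => v; rewrite !inE andbC. Qed.

Lemma set_of_link_verts W (x : 'I_n) :
  set_of_bits (link_verts W x) = unjoined adj_rel (set_of_bits W) x.
Proof. by rewrite set_of_mkseq; apply/setP => v; rewrite !inE. Qed.

Lemma set_of_inj : {in [pred s | size s == n] &, injective set_of_bits}.
Proof.
move=> s s'; rewrite !inE => /eqP sz /eqP sz' /setP eq_s.
apply: (@eq_from_nth _ false); rewrite sz // => i ltin.
by have := eq_s (Ordinal ltin); rewrite !inE.
Qed.

Lemma card_set_of s : size s = n -> #|set_of_bits s| = count id s.
Proof.
move=> sz; rewrite -sum1_card -sum1_count (big_nth false) sz big_mkord.
by apply: eq_bigl => i; rewrite inE.
Qed.

Lemma isolatedE s (v : 'I_n) : size s = n ->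
  isolated s v = [forall u in set_of_bits s, ~~ adj_rel v u].
Proof.
move=> sz; apply/hasPn/forall_inP => [iso u|iso u vu].
  by rewrite inE => su; apply: contraL su => /iso.
(* An entry of an adjacency list outside the vertex range reads the default bit [false]. *)
have [ltun|] := ltnP u n; last by move=> ?; rewrite nth_default ?sz.
apply/negP => su; have := iso (Ordinal ltun).
by rewrite inE su /adj_rel vu => /(_ isT).
Qed.

Lemma is_facet_size W f : is_facet W f -> size f = n.
Proof. by move/eqP->; rewrite size_mkseq. Qed.

Hypotheses (adj_sym : symmetric adj_rel) (adj_irr : irreflexive adj_rel).

Lemma is_facetE W f : size f = n ->
  is_facet W f = (set_of_bits f \in facets (Indr adj_rel (set_of_bits W))).
Proof.
move=> sz; rewrite (facets_Indr adj_sym adj_irr) /is_facet.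
rewrite -(inj_in_eq set_of_inj) ?inE ?size_mkseq ?sz //.
congr (_ == _); rewrite set_of_mkseq; apply/setP => v.
by rewrite !inE isolatedE.
Qed.

Definition bits k (F : {set 'I_n}) : bitseq :=
  mkseq (fun i => i \in [seq val x | x <- enum F]) k.

Lemma bitsK F : set_of_bits (bits n F) = F.
Proof.
rewrite set_of_mkseq; apply/setP => i.
by rewrite inE mem_map ?mem_enum //; apply: val_inj.
Qed.

(** Induction on the length of the prefix of [F]: a new [true] bit passes the test because its
    earlier neighbours are not in the independent set [F]. *)
Lemma bits_indep W F k :
  F \in Indr adj_rel (set_of_bits W) -> k <= n -> bits k F \in indep_seq W k.
Proof.
rewrite in_Indr => /andP[/IndP IF /subsetP FW].
elim: k => [|k IHk] // ltkn; have /IHk {}IHk := ltnW ltkn.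
rewrite /bits mkseqS mem_cat /=.
case: (boolP (k \in _)) => [/mapP[x]|_]; last first.
  by rewrite (map_f (rcons^~ false) IHk).
rewrite mem_enum => Fx kx.
have := FW _ Fx; rewrite inE -kx => ->.
rewrite (map_f (rcons^~ true)) ?orbT // mem_filter IHk andbT.
apply/hasPn => u ku; apply/negP; have [ltuk|leku] := ltnP u k; last first.
  by rewrite nth_default // size_mkseq.
rewrite nth_mkseq // => /mapP[y]; rewrite mem_enum => Fy uy.
by have := IF x y Fx Fy; rewrite /adj_rel /= -kx -uy ku.
Qed.

Lemma facet_seq_complete W F :
  F \in facets (Indr adj_rel (set_of_bits W)) -> bits n F \in facet_seq W.
Proof.
move=> facF; rewrite mem_filter is_facetE ?size_mkseq // bitsK facF /=.
by apply: bits_indep => //; move: facF; rewrite inE => /maxsetP[].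
Qed.

(** * Checking a shelling by computation *)

Definition diff_seq s s' : seq nat :=
  [seq x <- iota 0 n | nth false s x && ~~ nth false s' x].

Lemma diff_seqE s s' (x : nat) : diff_seq s s' = [:: x] ->
  exists2 i : 'I_n, val i = x & set_of_bits s :\: set_of_bits s' = [set i].
Proof.
move=> dE; have : x \in diff_seq s s' by rewrite dE mem_head.
rewrite mem_filter mem_iota => /andP[_ ltxn].
exists (Ordinal ltxn) => //; apply/setP => i; rewrite !inE.
have : (val i \in diff_seq s s') = (val i == x) by rewrite dE inE.
by rewrite mem_filter mem_iota /= ltn_ord andbT [_ && ~~ _]andbC => ->.
Qed.

(* The restriction set of [f]: the vertices in which [f] differs from an earlier
   facet by exactly one exchange. *)
Definition restriction (ss : seq bitseq) f : seq nat :=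
  flatten [seq d <- [seq diff_seq f s | s <- ss] | size d == 1].

(** The common size [d] gives purity. The last conjunct is the exchange condition: each earlier
    facet misses some vertex of the restriction set, and that vertex alone is lost on passing to
    some earlier facet. *)
Definition shelling_check W d (ss : seq bitseq) : bool :=
  [&& uniq ss, all (is_facet W) ss, all (fun f => f \in ss) (facet_seq W),
      all (fun s => count id s == d) ss &
      all (fun i => let rs := restriction (take i ss) (nth [::] ss i) in
             all (fun s => has (fun x => ~~ nth false s x) rs) (take i ss))
          (iota 0 (size ss))].

Lemma shellable_check W d ss :
  shelling_check W d ss -> shellable (Indr adj_rel (set_of_bits W)).
Proof.
case/and5P => ss_uniq /allP ss_fac /allP ss_all /allP ss_card /allP ss_shell.
have ss_size s : s \in ss -> size s = n by move/ss_fac/is_facet_size.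
have facetsE : map set_of_bits ss =i facets (Indr adj_rel (set_of_bits W)).
  move=> F; apply/mapP/idP => [[s sss ->]|facF].
    by rewrite -is_facetE ?ss_size ?ss_fac.
  by exists (bits n F); rewrite ?bitsK ?ss_all ?facet_seq_complete.
split.
  split=> [|F F']; first exact: Indr_complex.
  rewrite -!facetsE => /mapP[s /[dup] sss /ss_card/eqP sd ->].
  move=> /mapP[s' /[dup] sss' /ss_card/eqP s'd ->].
  by rewrite !card_set_of ?ss_size // sd s'd.
exists (map set_of_bits ss); split=> // [|i j].
  rewrite map_inj_in_uniq // => s s' sss sss'.
  by apply: set_of_inj; rewrite inE ss_size.
rewrite size_map => /andP[ji isz]; have jsz := ltn_trans ji isz.
have nth_set k : k < size ss ->
    nth set0 (map set_of_bits ss) k = set_of_bits (nth [::] ss k).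
  by move=> ksz; rewrite (nth_map [::]).
have := ss_shell i; rewrite mem_iota isz => /(_ isT) /allP.
have : nth [::] ss j \in take i ss.
  by rewrite -(nth_take _ ji) mem_nth // size_take isz.
move=> + H => /H {H} /hasP[x /flattenP[t]].
rewrite mem_filter => /andP[/eqP t1 /mapP[s s_in tE]] xt xj.
have {}tE : diff_seq (nth [::] ss i) s = [:: x].
  by rewrite -tE; case: t t1 xt {tE} => [|a [|]] //= _; rewrite inE => /eqP->.
have [y yx dE] := diff_seqE tE.
have k_lt : index s ss < i by apply: index_ltn.
have sss : s \in ss by apply: mem_take s_in.
exists y, (index s ss); rewrite !nth_set ?nth_index ?index_mem //; split=> //.
have : y \in set_of_bits (nth [::] ss i) :\: set_of_bits s by rewrite dE set11.
by rewrite !inE yx xj => /andP[].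
Qed.

(** * Symmetries and the certificate of non-decomposability *)

Definition automorphism_check q : bool :=
  [&& size q == n, uniq q, all (fun i => i < n) q &
      all (fun i => all (fun j =>
        (nth 0 q j \in nbr (nth 0 q i)) == (j \in nbr i)) (iota 0 n)) (iota 0 n)].

Definition pull q D : bitseq := [seq nth false D i | i <- q].

Lemma automorphism_checkP q : automorphism_check q ->
  exists2 t : 'I_n -> 'I_n, injective t &
    {mono t : i j / adj_rel i j} /\
    forall D, set_of_bits (pull q D) = t @^-1: set_of_bits D.
Proof.
case/and4P => /eqP q_size q_uniq /allP q_lt /allP q_adj.
have lt_q (i : 'I_n) : nth 0 q i < n by rewrite q_lt ?mem_nth ?q_size.
exists (fun i => Ordinal (lt_q i)).
  by move=> i j [] /eqP; rewrite nth_uniq ?q_size // => /eqP/val_inj.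
split=> [i j|D].
  have in_iota (k : 'I_n) : val k \in iota 0 n by rewrite mem_iota ltn_ord.
  by have /allP/(_ _ (in_iota j))/eqP := q_adj _ (in_iota i).
by apply/setP => i; rewrite !inE (nth_map 0) ?q_size.
Qed.

(** An automorphism is a blow-up map with one-point fibres, so the descent along blow-ups transports
    decomposability. *)
Lemma vertex_decomposable_pull q D : automorphism_check q ->
    vertex_decomposable (Indr adj_rel (set_of_bits D)) ->
  vertex_decomposable (Indr adj_rel (set_of_bits (pull q D))).
Proof.
case/automorphism_checkP => t t_inj [t_mono ->] vdD.
have [t' tK t'K] := injF_bij t_inj.
have -> : t @^-1: set_of_bits D = t' @: set_of_bits D.
  by rewrite (can2_imset_pre _ t'K tK).
apply: (vertex_decomposable_blowup adj_sym adj_irr).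
(* As [t'] is a bijective automorphism, the blow-up along it is the graph itself. *)
suff -> : Indr (blowup adj_rel t') (set_of_bits D) =
    Indr adj_rel (set_of_bits D) by [].
apply/setP => A; rewrite !in_Indr; congr andb.
have eqR : blowup adj_rel t' =2 adj_rel.
  move=> i j; rewrite /blowup -t_mono !t'K (can_eq t'K).
  by case: eqP => [->|]; rewrite ?adj_irr ?orbF.
by apply/IndP/IndP => IA i j Ai Aj; have := IA i j Ai Aj; rewrite eqR.
Qed.

Lemma card_pull q D : automorphism_check q ->
  #|set_of_bits (pull q D)| = #|set_of_bits D|.
Proof.
by case/automorphism_checkP => t t_inj [_ ->]; rewrite card_preimset.
Qed.

(* Facets of a pure complex avoiding [x] keep their size in the deletion, so a
   facet [f] through [x] with [f :\ x] maximal in the deletion spoils purity. *)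
Definition impure_deletion (fs : seq bitseq) W x : bool :=
  has (fun f => ~~ nth false f x) fs &&
  has (fun f => nth false f x && is_facet (remove W x) (remove f x)) fs.

(** Two distinct facets exclude the simplex case. A vertex is ruled out as soon as either its
    deletion or its link fails, so one obstruction per vertex suffices. *)
Definition state_check (Q : seq (seq nat)) C W : bool :=
  let known D := has (fun q => pull q D \in C) Q in
  let fs := facet_seq W in
  (if fs is [:: f, f' & _] then f != f' else false) &&
  all (fun x => nth false W x ==>
         [|| impure_deletion fs W x, known (remove W x) | known (link_verts W x)])
      (iota 0 n).

Lemma impure_deletionP W (x : 'I_n) : impure_deletion (facet_seq W) W x ->
    pure_complex (Indr adj_rel (set_of_bits W)) ->
  ~ pure_complex (Indr adj_rel (set_of_bits W :\ x)).
Proof.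
move=> /andP[/hasP[f + fx] /hasP[f' + /andP[f'x facD]]].
rewrite !mem_filter => /andP[facf _] /andP[facf' _] [_ eqW] [_ eqD].
have := is_facet_size facf; have := is_facet_size facf' => szf' szf.
rewrite is_facetE // in facf; rewrite is_facetE // in facf'.
rewrite is_facetE ?size_mkseq // !set_of_remove in facD.
have facfD := facets_del adj_sym adj_irr facf (_ : x \notin set_of_bits f).
have := eqD _ _ (facfD _) facD; rewrite inE fx => /(_ isT).
have := eqW _ _ facf facf' => ->; rewrite (cardsD1 x (set_of_bits f')) inE f'x.
by rewrite add1n => /esym/n_Sn.
Qed.

(** Induction on the number of vertices: a deletion or link has fewer vertices than [W], and
    symmetries preserve this number, so the closure of the list can be used recursively. *)
Lemma not_vertex_decomposable_check Q C :
    all automorphism_check Q -> all (state_check Q C) C ->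
  forall W, W \in C -> ~ vertex_decomposable (Indr adj_rel (set_of_bits W)).
Proof.
move=> /allP autQ /allP stC W; have [k] := ubnP #|set_of_bits W|.
elim: k W => // k IHk W; rewrite ltnS => cardW CW.
have known_nvd D : #|set_of_bits D| < #|set_of_bits W| ->
    has (fun q => pull q D \in C) Q ->
    ~ vertex_decomposable (Indr adj_rel (set_of_bits D)).
  move=> ltD /hasP[q /autQ autq CD] /(vertex_decomposable_pull autq).
  by apply: IHk => //; rewrite card_pull // (leq_trans ltD).
have /andP[facs /allP verts] := stC W CW.
case=> [_ /eqP/cards1P[F0 FE]|x pureW].
  (* The first two enumerated facets would both represent the unique facet [F0], but they differ. *)
  move: facs; case fsE: (facet_seq W) => [|f [|f' fs]] //; case/eqP.
  have f_in : f \in facet_seq W by rewrite fsE mem_head.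
  have f'_in : f' \in facet_seq W by rewrite fsE !inE eqxx orbT.
  have facP g : g \in facet_seq W -> size g = n /\ set_of_bits g = F0.
    rewrite mem_filter => /andP[/[dup] /is_facet_size sz]; rewrite is_facetE //.
    by rewrite FE inE => /eqP.
  have [[sz <-] [sz' eqf]] := (facP _ f'_in, facP _ f_in).
  by apply: set_of_inj eqf; rewrite inE ?sz ?sz'.
rewrite (set1_Indr adj_irr) del_Indr => Wx; rewrite link_Indr // => vdD vdL.
have := verts x; rewrite mem_iota ltn_ord => /(_ isT).
move: (Wx); rewrite inE => -> /= /or3P[/impure_deletionP| |].
- by apply=> //; case: vdD.
- move=> kn; move: vdD; rewrite -set_of_remove; apply: known_nvd kn.
  rewrite set_of_remove.
  by rewrite [X in _ < X](cardsD1 x) Wx add1n.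
- move=> kn; move: vdL; rewrite -set_of_link_verts; apply: known_nvd kn.
  rewrite set_of_link_verts.
  apply/proper_card/properP; split.
    by apply/subsetP => y; rewrite inE => /andP[].
  by exists x => //; rewrite inE eqxx andbF.
Qed.

End Bits.

(** * The graph C_16(1,4,8) *)

(** The steps 12 and 15 are -4 and -1 modulo 16. *)
Definition adj16 : seq (seq nat) := Eval vm_compute in
  mkseq (fun i => [seq (i + d) %% 16 | d <- [:: 1; 4; 8; 12; 15]]) 16.

Definition bits16 (A : seq nat) : bitseq := mkseq (fun i => i \in A) 16.
Definition cobits16 (A : seq nat) : bitseq := mkseq (fun i => i \notin A) 16.

Definition full16 : bitseq := nseq 16 true.

(* Found by a greedy computer search. *)
Definition shelling16 : seq (seq nat) := [::
    [:: 0; 2; 5; 7]; [:: 0; 5; 7; 10]; [:: 2; 5; 7; 12]; [:: 0; 2; 5; 11];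
    [:: 0; 3; 5; 10]; [:: 0; 7; 10; 13]; [:: 2; 5; 8; 11]; [:: 0; 5; 11; 14];
    [:: 5; 8; 11; 14]; [:: 0; 3; 10; 13]; [:: 1; 8; 11; 14]; [:: 0; 5; 7; 14];
    [:: 2; 5; 8; 15]; [:: 0; 3; 5; 14]; [:: 1; 6; 8; 11]; [:: 0; 2; 9; 11];
    [:: 1; 4; 11; 14]; [:: 0; 9; 11; 14]; [:: 0; 2; 7; 13]; [:: 5; 7; 12; 14];
    [:: 1; 4; 6; 11]; [:: 5; 7; 10; 12]; [:: 0; 3; 9; 14]; [:: 3; 5; 8; 14];
    [:: 0; 2; 11; 13]; [:: 0; 7; 9; 14]; [:: 3; 5; 10; 12]; [:: 7; 9; 12; 14];
    [:: 3; 5; 8; 10]; [:: 1; 3; 8; 14]; [:: 3; 5; 12; 14]; [:: 3; 8; 10; 13];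
    [:: 3; 9; 12; 14]; [:: 2; 5; 12; 15]; [:: 5; 8; 10; 15]; [:: 1; 3; 6; 8];
    [:: 4; 9; 11; 14]; [:: 5; 10; 12; 15]; [:: 8; 10; 13; 15];
    [:: 4; 7; 9; 14]; [:: 2; 4; 9; 11]; [:: 1; 3; 12; 14]; [:: 0; 2; 7; 9];
    [:: 3; 6; 8; 13]; [:: 0; 3; 6; 13]; [:: 1; 3; 6; 12]; [:: 2; 4; 11; 13];
    [:: 0; 3; 6; 9]; [:: 6; 8; 13; 15]; [:: 2; 4; 7; 9]; [:: 1; 6; 8; 15];
    [:: 1; 8; 10; 15]; [:: 2; 7; 9; 12]; [:: 3; 6; 9; 12]; [:: 1; 3; 8; 10];
    [:: 1; 4; 6; 15]; [:: 2; 4; 7; 13]; [:: 1; 4; 7; 14]; [:: 1; 4; 10; 15];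
    [:: 1; 3; 10; 12]; [:: 2; 9; 12; 15]; [:: 1; 10; 12; 15];
    [:: 1; 6; 12; 15]; [:: 1; 7; 12; 14]; [:: 6; 9; 12; 15]; [:: 1; 7; 10; 12];
    [:: 1; 4; 7; 10]; [:: 4; 7; 10; 13]; [:: 4; 10; 13; 15]; [:: 4; 6; 13; 15];
    [:: 4; 6; 11; 13]; [:: 0; 6; 11; 13]; [:: 6; 8; 11; 13]; [:: 2; 8; 11; 13];
    [:: 0; 6; 9; 11]; [:: 4; 6; 9; 11]; [:: 4; 6; 9; 15]; [:: 2; 4; 9; 15];
    [:: 2; 8; 13; 15]; [:: 2; 4; 13; 15]].

(** Rotating [iota 0 16] by [k] gives the map sending [i] to [i + k]; rotating its reversal gives
    the reflection sending [i] to [15 - k - i], modulo 16. *)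
Definition dihedral16 : seq (seq nat) :=
  [seq rot k (iota 0 16) | k <- iota 0 16] ++
  [seq rot k (rev (iota 0 16)) | k <- iota 0 16].

(* Each entry is the set of deleted vertices of an induced subgraph, taken up to
   the dihedral symmetry, whose independence complex is not vertex decomposable.
   The list was found by computer search. *)
Definition cores16 : seq (seq nat) := [::
    [::]; [:: 15]; [:: 14; 15]; [:: 13; 15]; [:: 12; 15]; [:: 10; 15];
    [:: 9; 15]; [:: 8; 15]; [:: 13; 14; 15]; [:: 12; 14; 15]; [:: 10; 13; 15];
    [:: 9; 14; 15]; [:: 9; 12; 15]; [:: 8; 14; 15]; [:: 8; 13; 15];
    [:: 6; 12; 15]; [:: 5; 10; 15]; [:: 12; 13; 14; 15]; [:: 9; 12; 14; 15];
    [:: 8; 13; 14; 15]; [:: 8; 10; 13; 15]; [:: 8; 9; 14; 15];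
    [:: 6; 9; 12; 15]; [:: 5; 12; 14; 15]; [:: 5; 8; 14; 15];
    [:: 4; 10; 13; 15]; [:: 4; 9; 14; 15]; [:: 2; 10; 13; 15];
    [:: 1; 12; 14; 15]; [:: 5; 9; 12; 14; 15]; [:: 5; 8; 10; 13; 15];
    [:: 2; 7; 10; 13; 15]; [:: 1; 9; 12; 14; 15]; [:: 4; 8; 11; 13; 14; 15];
    [:: 4; 7; 9; 12; 14; 15]; [:: 2; 5; 9; 12; 14; 15];
    [:: 2; 5; 8; 10; 13; 15]; [:: 2; 5; 7; 10; 13; 15];
    [:: 1; 6; 9; 12; 14; 15]; [:: 1; 4; 9; 12; 14; 15];
    [:: 1; 4; 8; 11; 13; 14; 15]; [:: 1; 4; 7; 9; 12; 14; 15];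
    [:: 2; 5; 6; 10; 12; 13; 14; 15]; [:: 2; 5; 6; 7; 10; 13; 14; 15];
    [:: 1; 4; 6; 7; 9; 12; 14; 15]; [:: 3; 4; 7; 10; 11; 12; 13; 14; 15];
    [:: 2; 6; 9; 10; 11; 12; 13; 14; 15]; [:: 2; 5; 6; 7; 10; 12; 13; 14; 15];
    [:: 2; 4; 5; 6; 7; 10; 12; 13; 14; 15];
    [:: 2; 3; 4; 5; 6; 7; 10; 11; 12; 13; 14; 15]].

Lemma shelling16_check :
  shelling_check 16 adj16 full16 4 (map bits16 shelling16).
Proof. by vm_compute. Qed.

Lemma dihedral16_check : all (automorphism_check 16 adj16) dihedral16.
Proof. by vm_compute. Qed.

Lemma cores16_check :
  let C := map cobits16 cores16 in all (state_check 16 adj16 dihedral16 C) C.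
Proof. by vm_compute. Qed.

Lemma forall_ltn_check n (P : rel nat) :
  all (fun i => all (P i) (iota 0 n)) (iota 0 n) ->
  forall i j, i < n -> j < n -> P i j.
Proof.
move=> /allP chk i j ltin ltjn; have in_iota k : k < n -> k \in iota 0 n.
  by rewrite mem_iota.
by have /allP := chk i (in_iota i ltin); apply; apply: in_iota.
Qed.

(** * Expansions and lexicographic products as blow-ups *)

Lemma eq_Ind (T : finType) (e e' : rel T) : e =2 e' -> Ind e = Ind e'.
Proof.
move=> eqe; apply/setP => A.
by apply/IndP/IndP => IA x y Ax Ay; have := IA x y Ax Ay; rewrite eqe.
Qed.

Lemma lexprod_blowup (T : finType) (e : rel T) m : irreflexive e ->
  lexprod e (@complete m) =2 blowup e (@fst T 'I_m).
Proof.
move=> e_irr [a i] [b j]; rewrite /lexprod /blowup /complete /= xpair_eqE.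
by case: eqP => [->|]; rewrite ?e_irr ?orbF //= andbT.
Qed.

Lemma expansion_lexprod_iso (T : finType) (e : rel T) m : irreflexive e ->
  graph_iso (@expansion T e (fun _ => m)) (lexprod e (@complete m)).
Proof.
move=> e_irr; pose f (u : {i : T & 'I_m}) := (tag u, tagged u).
have fK : cancel f (fun u => @Tagged T u.1 (fun _ => 'I_m) u.2) by case.
exists f => [|u v]; first by apply: Bijective fK _; case.
by rewrite lexprod_blowup // /blowup /expansion (can_eq fK).
Qed.

(** * Shellability and non-decomposability of the circulant graph itself *)

Local Notation C16 := (@circulant 16 [:: 1; 4; 8]).

Lemma circulant16_simple : simple_graph C16.
Proof. by apply: circulant_simple => // d; rewrite !inE => /or3P[]/eqP->. Qed.

Lemma circulant16_adj : C16 =2 adj_rel adj16.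
Proof.
pose P (a b : nat) :=
  (b \in nbr adj16 a) ==
  ((`|a - b|%N \in [:: 1; 4; 8]) || (16 - `|a - b|%N \in [:: 1; 4; 8])).
have chk : all (fun i => all (P i) (iota 0 16)) (iota 0 16) by vm_compute.
by move=> i j; apply/esym/eqP; apply: (forall_ltn_check chk); apply: ltn_ord.
Qed.

Lemma set_of_full16 : set_of_bits 16 full16 = setT.
Proof. by apply/setP => i; rewrite !inE nth_nseq ltn_ord. Qed.

Lemma shellable_circulant16 : shellable (Ind C16).
Proof.
have [eqG [sym irr]] := (circulant16_adj, circulant16_simple).
rewrite (eq_Ind eqG) -Indr_setT -set_of_full16.
apply: shellable_check shelling16_check => [i j|i]; rewrite -!eqG.
  exact: sym.
exact: irr.
Qed.

Lemma not_vertex_decomposable_circulant16 : ~ vertex_decomposable (Ind C16).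
Proof.
have [eqG [sym irr]] := (circulant16_adj, circulant16_simple).
rewrite (eq_Ind eqG) -Indr_setT -set_of_full16.
(* The whole graph is in the list as the entry [[::]], with no vertex deleted. *)
apply: not_vertex_decomposable_check dihedral16_check cores16_check _ _ => //.
- by move=> i j; rewrite -!eqG; apply: sym.
- by move=> i; rewrite -eqG; apply: irr.
Qed.

(** * Lexicographic products with complete graphs as circulant graphs *)

Definition residues16 : seq nat := [:: 0; 1; 4; 8; 12; 15].
(** Residue 0 accounts for pairs in one fibre, the others for the differences 1, 4, 8 up to sign.
    The bound [8 * m] is half the number of vertices. *)
Definition circulant_lexprod_set m : seq nat :=
  [seq d <- iota 1 (8 * m) | d %% 16 \in residues16].

Lemma mem_circulant_lexprod_set m d :
  d \in circulant_lexprod_set m =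
  [&& 0 < d, d <= 8 * m & d %% 16 \in residues16].
Proof. by rewrite mem_filter mem_iota add1n ltnS andbC andbA. Qed.

(** [residues16] is stable under negation modulo 16, so a distance [d] and [16 * m - d] pass the
    residue test together, and one of them is at most [8 * m]. *)
Lemma circulant_lexprodE m (x y : 'I_(16 * m)) :
  circulant (circulant_lexprod_set m) x y =
  (x != y) && (`|x - y|%N %% 16 \in residues16).
Proof.
rewrite /circulant !mem_circulant_lexprod_set -(inj_eq val_inj) /=.
have dlt : `|x - y|%N < 16 * m by have := ltn_ord x; have := ltn_ord y; lia.
have <- : (0 < `|x - y|%N) = (x != y :> nat) by lia.
move: `|x - y|%N dlt => d dlt.
have -> : ((16 * m - d) %% 16 \in residues16) = (d %% 16 \in residues16).
  by rewrite !inE; lia.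
by case: (d %% 16 \in _); rewrite ?andbF // !andbT; lia.
Qed.

Lemma lexprod_circulant16 (a b : 'I_16) (i j : nat) :
  C16 a b || (a == b) = (`|a + 16 * i - (b + 16 * j)|%N %% 16 \in residues16).
Proof.
rewrite -(inj_eq val_inj) /circulant /= !inE.
by have := ltn_ord a; have := ltn_ord b; lia.
Qed.

(** Numbering [(a, i)] by [a + 16 * i] makes the fibres residue classes modulo 16, so adjacency
    depends only on the difference of the numbers. *)
Lemma is_circulant_lexprod16 m : 0 < m -> is_circulant (lexprod C16 (@complete m)).
Proof.
move=> m_gt0; exists (16 * m), (circulant_lexprod_set m); split.
- by rewrite muln_gt0.
- by move=> d; rewrite mem_circulant_lexprod_set => /and3P[-> le_d _]; lia.
have lt_f (u : 'I_16 * 'I_m) : u.1 + 16 * u.2 < 16 * m.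
  by have := ltn_ord u.1; have := ltn_ord u.2; lia.
have m16 : 16 * m = #|{: 'I_16 * 'I_m}| by rewrite card_prod !card_ord.
exists (fun u => Ordinal (lt_f u)).
  apply: inj_card_bij; last by rewrite card_ord m16.
  move=> [a i] [b j] [] /= eq_f; have := ltn_ord a; have := ltn_ord b.
  by move=> ltb lta; congr pair; apply: val_inj => /=; lia.
move=> [a i] [b j]; rewrite circulant_lexprodE.
rewrite (lexprod_blowup circulant16_simple.2) /blowup /= (lexprod_circulant16 a b i j); congr andb; congr negb.
have := ltn_ord a; have := ltn_ord b => ltb lta.
rewrite xpair_eqE -!(inj_eq val_inj) /=; lia.
Qed.

Theorem theorem4p4 :
  let G : rel 'I_16 := @circulant 16 [:: 1; 4; 8] in
  (forall s : 'I_16 -> nat, (forall i, 0 < s i) ->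
     shellable (Ind (@expansion _ G s)) /\
     ~ vertex_decomposable (Ind (@expansion _ G s)))
  /\
  (forall m : nat, 1 <= m ->
     [/\ graph_iso (@expansion _ G (fun _ => m)) (lexprod G (@complete m)),
         is_circulant (lexprod G (@complete m)),
         shellable (Ind (lexprod G (@complete m))) &
         ~ vertex_decomposable (Ind (lexprod G (@complete m)))]).
Proof.
have [sym irr] := circulant16_simple.
have [shG nvdG] := (shellable_circulant16, not_vertex_decomposable_circulant16).
move=> H; split=> [s s_gt0|m m_gt0].
  (* Positivity of [s] makes every fibre of [tag] nonempty; [expansion] unfolds to the blow-up along
     [tag]. *)
  have surj i : exists u : {i : 'I_16 & 'I_(s i)}, tag u = i.
    by exists (@Tagged _ i (fun i => 'I_(s i)) (Ordinal (s_gt0 i))).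
  by split; [apply: shellable_blowup|apply: not_vertex_decomposable_blowup].
have surj i : exists u : 'I_16 * 'I_m, u.1 = i by exists (i, Ordinal m_gt0).
rewrite (eq_Ind (@lexprod_blowup _ _ m irr)); split.
- exact: expansion_lexprod_iso.
- exact: is_circulant_lexprod16.
- exact: shellable_blowup.
- exact: not_vertex_decomposable_blowup.
Qed.
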